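(* For any formulae $\alpha,\beta\in\mathcal{F}$, the following are equivalent: (a) $\alpha\vdash_{\mathcal{L}_K}\beta$ (the consequent $\alpha\vdash\beta$ is derivable in the logic $\mathcal{L}_K$); (b) $\alpha\vDash_{\mathcal{A}_K}\beta$, where $\mathcal{A}_K$ is the class of all Kleene algebras; (c) $\alpha\vDash_{\mathcal{A}_{K\mathcal{RS}}}\beta$, where $\mathcal{A}_{K\mathcal{RS}}$ is the class of the Kleene algebras $\mathcal{RS}$ of rough sets over all possible approximation spaces $(U,R)$; (d) $\alpha\vDash_{t,f}\beta$; (e) $\alpha\vDash_{\mathbb{F}_K}\beta$, where $\mathbb{F}_K$ is the class of all Kleene frames.
   Context: Formulae: $\mathcal{F}$ is the set of formulae built from propositional variables $p,q,r,\dots$ and constants $\top,\bot$ using $\vee,\wedge,\sim$. Logic $\mathcal{L}_K$: derivability of consequents $\alpha\vdash\beta$ ($\alpha,\beta\in\mathcal{F}$) is given by the following postulates and rules (premises before ''/'', conclusion after), for all $\alpha,\beta,\gamma\in\mathcal{F}$: 1. $\alpha\vdash\alpha$. 2. $\alpha\vdash\beta,\ \beta\vdash\gamma\ /\ \alpha\vdash\gamma$. 3. $\alpha\wedge\beta\vdash\alpha$, $\alpha\wedge\beta\vdash\beta$. 4. $\alpha\vdash\beta,\ \alpha\vdash\gamma\ /\ \alpha\vdash\beta\wedge\gamma$. 5. $\alpha\vdash\gamma,\ \beta\vdash\gamma\ /\ \alpha\vee\beta\vdash\gamma$. 6. $\alpha\vdash\alpha\vee\beta$, $\beta\vdash\alpha\vee\beta$.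 7. $\alpha\wedge(\beta\vee\gamma)\vdash(\alpha\wedge\beta)\vee(\alpha\wedge\gamma)$. 8. $\alpha\vdash\beta\ /\ \sim\beta\vdash\sim\alpha$. 9. $\sim\alpha\wedge\sim\beta\vdash\sim(\alpha\vee\beta)$. 10. $\alpha\vdash\top$. 11. $\bot\vdash\alpha$. 12. $\top\vdash\sim\bot$. 13. $\alpha\vdash\sim\sim\alpha$. 14. $\sim\sim\alpha\vdash\alpha$. 15. $\alpha\wedge\sim\alpha\vdash\beta\vee\sim\beta$. Algebraic semantics: a Kleene algebra is an algebra $(K,\vee,\wedge,\sim,0,1)$ such that $(K,\vee,\wedge,0,1)$ is a bounded distributive lattice and, for all $a,b$: $\sim(a\wedge b)=\sim a\vee\sim b$, $\sim\sim a=a$, $a\wedge\sim a\le b\vee\sim b$. A valuation on $K$ is a map $v:\mathcal{F}\to K$ with $v(\alpha\vee\beta)=v(\alpha)\vee v(\beta)$, $v(\alpha\wedge\beta)=v(\alpha)\wedge v(\beta)$, $v(\sim\alpha)=\sim v(\alpha)$, $v(\bot)=0$, $v(\top)=1$. For a class $\mathcal{A}$ of Kleene algebras, $\alpha\vDash_{\mathcal{A}}\beta$ means $v(\alpha)\le v(\beta)$ for every $K\in\mathcal{A}$ and every valuation $v$ on $K$. Rough sets: an approximation space is a pair $(U,R)$, $R$ an equivalence relation on the set $U$, with classes $[x]$. For $A\subseteq U$, $\mathsf{L}A:=\bigcup\{[x]:[x]\subseteq A\}$, $\mathsf{U}A:=\bigcup\{[x]:[x]\cap A\ne\emptyset\}$,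 and $\mathcal{RS}:=\{(\mathsf{L}A,\mathsf{U}A):A\subseteq U\}$, which is a Kleene algebra under componentwise union and intersection, $\sim(D_1,D_2):=(U\setminus D_2,U\setminus D_1)$, bottom $(\emptyset,\emptyset)$, top $(U,U)$. 3-valued semantics: $\mathbf{3}$ is the three-element Kleene algebra $f<u<t$ with $\sim f=t$, $\sim u=u$, $\sim t=f$. $\alpha\vDash_{t,f}\beta$ means: for every valuation $v$ on $\mathbf{3}$, if $v(\alpha)=t$ then $v(\beta)=t$; and for every valuation $v$ on $\mathbf{3}$, if $v(\beta)=f$ then $v(\alpha)=f$. Perp semantics: a compatibility frame is a triple $(W,C,\le)$ where $(W,\le)$ is a partially ordered set and $C$ is a binary relation on $W$ such that $x'\le x$, $y'\le y$ and $xCy$ imply $x'Cy'$. An evaluation is a relation $\vDash$ between points of $W$ and propositional variables such that $x\vDash p$ and $x\le y$ imply $y\vDash p$; it is extended to $\mathcal{F}$ by: $x\vDash\alpha\wedge\beta$ iff $x\vDash\alpha$ and $x\vDash\beta$; $x\vDash\alpha\vee\beta$ iff $x\vDash\alpha$ or $x\vDash\beta$; $x\vDash\top$; $x\nvDash\bot$; $x\vDash\sim\alpha$ iff for all $y$, $xCy$ implies $y\nvDash\alpha$. The consequent $\alpha\vdash\beta$ is valid in a frame if for every evaluation and every $x\in W$, $x\vDash\alpha$ implies $x\vDash\beta$; $\alpha\vDash_{\mathbb{F}}\beta$ means it is valid in every frame of the class $\mathbb{F}$. A Kleene frame is a compatibility frame satisfying: (1) $\forall x\forall y(xCy\to yCx)$;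 (2) $\forall x\exists y(xCy\wedge\forall z(yCz\to z\le x))$; (3) $\forall x(xCx\vee\forall y(xCy\to y\le x))$. *)

(* Defs.v *)
From HB Require Import structures.
From mathcomp Require Import all_boot all_order.
From mathcomp Require Import boolp classical_sets.
From Corelib Require Import Relation_Definitions(equivalence).

Set Implicit Arguments.
Unset Strict Implicit.
Unset Printing Implicit Defensive.

Import Order.TTheory.

Local Open Scope order_scope.

Inductive formula : Type :=
| Var of nat
| Top
| Bot
| Or of formula & formula
| And of formula & formula
| Neg of formula.

(* [derivable a b] is derivability of the consequent [a |- b] in L_K. *)
Inductive derivable : formula -> formula -> Prop :=
| d_refl a : derivable a a
| d_trans a b c : derivable a b -> derivable b c -> derivable a c
| d_andl a b : derivable (And a b) a
| d_andr a b : derivable (And a b) b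
| d_and a b c : derivable a b -> derivable a c -> derivable a (And b c)
| d_or a b c : derivable a c -> derivable b c -> derivable (Or a b) c
| d_orl a b : derivable a (Or a b)
| d_orr a b : derivable b (Or a b)
| d_distr a b c :
    derivable (And a (Or b c)) (Or (And a b) (And a c))
| d_contra a b : derivable a b -> derivable (Neg b) (Neg a)
| d_neg_or a b : derivable (And (Neg a) (Neg b)) (Neg (Or a b))
| d_top a : derivable a Top
| d_bot a : derivable Bot a
| d_neg_bot : derivable Top (Neg Bot)
| d_dni a : derivable a (Neg (Neg a))
| d_dne a : derivable (Neg (Neg a)) a
| d_kleene a b : derivable (And a (Neg a)) (Or b (Neg b)).

(* The carrier is a choiceType because MathComp orders are. Under the classical
   axioms of mathcomp.classical every type is one ([gen_eqMixin],
   [gen_choiceMixin]) and every order is boolean ([asbool]), so this covers all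
   Kleene algebras; the one-element algebra is allowed. *)
HB.mixin Record TBDistrLattice_isKleene d K of Order.TBDistrLattice d K := {
  kneg : K -> K;
  kneg_meet : forall a b : K, kneg (a `&` b) = kneg a `|` kneg b;
  knegK : involutive kneg;
  meet_kneg_le : forall a b : K, a `&` kneg a <= b `|` kneg b
}.

#[short(type="kleeneType")]
HB.structure Definition Kleene d :=
  { K of TBDistrLattice_isKleene d K & Order.TBDistrLattice d K }.

Record valuation d (K : kleeneType d) (v : formula -> K) : Prop := Valuation {
  val_or : forall a b, v (Or a b) = v a `|` v b;
  val_and : forall a b, v (And a b) = v a `&` v b;
  val_neg : forall a, v (Neg a) = kneg (v a);
  val_bot : v Bot = \bot;
  val_top : v Top = \top
}.

Definition alg_entails (A : forall d, kleeneType d -> Prop) (a b : formula) :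
    Prop :=
  forall d (K : kleeneType d), A d K ->
  forall v : formula -> K, valuation v -> v a <= v b.

Definition all_kleene d (K : kleeneType d) : Prop := True.

Record approx_space : Type := ApproxSpace {
  points :> Type;
  indisc : points -> points -> Prop;
  indisc_equiv : equivalence points indisc
}.

Local Open Scope classical_set_scope.

Definition eqclass (S : approx_space) (x : S) : set S := [set y | indisc x y].

Definition lower (S : approx_space) (A : set S) : set S :=
  \bigcup_(x in [set x | eqclass x `<=` A]) eqclass x.

Definition upper (S : approx_space) (A : set S) : set S :=
  \bigcup_(x in [set x | eqclass x `&` A !=set0]) eqclass x.

Definition is_rough (S : approx_space) : pred (set S *p set S) :=
  fun D => `[< exists A : set S, D = (lower A, upper A) >].

Lemma lowerE (S : approx_space) (A : set S) x : lower A x <-> eqclass x `<=` A.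
Proof.
have [re tr sy] := indisc_equiv S.
split=> [[z /= zA zx] y xy|xA]; last by exists x => //; exact: re.
by apply: zA; exact: (tr _ _ _ zx xy).
Qed.

Lemma upperE (S : approx_space) (A : set S) x :
  upper A x <-> exists2 y, indisc x y & A y.
Proof.
have [re tr sy] := indisc_equiv S.
split=> [[z /= [y [zy Ay]] zx]|[y xy Ay]].
  by exists y => //; apply: (tr _ z _ _ zy); exact: sy.
by exists x; [exists y | exact: re].
Qed.

Lemma lowerC (S : approx_space) (A : set S) : lower (~` A) = ~` upper A.
Proof.
apply/seteqP; split=> x; first by move=> /lowerE h /upperE[y xy] /(h y xy).
by move=> h; apply/lowerE => y xy Ay; apply: h; apply/upperE; exists y.
Qed.

Lemma upperC (S : approx_space) (A : set S) : upper (~` A) = ~` lower A.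
Proof. by rewrite -[in RHS](setCK A) lowerC setCK. Qed.

Lemma is_roughC (S : approx_space) (D : set S *p set S) :
  D \in @is_rough S -> ((~` D.2, ~` D.1) : set S *p set S) \in @is_rough S.
Proof.
move=> /asboolP[A ->]; apply/asboolP; exists (~` A).
by rewrite lowerC upperC.
Qed.

Lemma is_roughI (S : approx_space) :
  {in @is_rough S &, forall D E, D `&` E \in @is_rough S}%O.
Proof.
have [re tr sy] := indisc_equiv S.
move=> _ _ /asboolP[A ->] /asboolP[B ->]; apply/asboolP.
exists ((A `&` B) `|` (A `&` upper B `&` ~` upper (A `&` B))).
congr pair; apply/seteqP; split=> x.
- move=> [/lowerE lA /lowerE lB]; apply/lowerE => y xy.
  by left; split; [exact: lA | exact: lB].
- move=> /lowerE h.
  have nC y : indisc x y -> (A `&` B) y.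
    move=> xy; case: (h y xy) => // -[[Ay /upperE[z yz Bz]] nAB].
    exfalso; apply: nAB; apply/upperE; exists z => //.
    case: (h z (tr _ _ _ xy yz)) => [//|[[Az _] _]]; by split.
  by split; apply/lowerE => y /nC[].
- move=> [/upperE[y xy Ay] uB].
  have [uAB|nAB] := pselect (upper (A `&` B) x).
    by have /upperE[z xz ABz] := uAB; apply/upperE; exists z => //; left.
  apply/upperE; exists y => //; right; split; [split=> //|].
    have /upperE[z xz Bz] := uB.
    by apply/upperE; exists z => //; apply: (tr _ x _ _ xz); exact: sy.
  move=> /upperE[z yz ABz]; apply: nAB; apply/upperE; exists z => //.
  exact: (tr _ _ _ xy yz).
- move=> /upperE[y xy [[Ay By]|[[Ay /upperE[z yz Bz]] _]]].
    by split; apply/upperE; exists y.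
  by split; apply/upperE; [exists y | exists z => //; exact: (tr _ _ _ xy yz)].
Qed.

Lemma is_roughU (S : approx_space) :
  {in @is_rough S &, forall D E, D `|` E \in @is_rough S}%O.
Proof.
move=> D E /is_roughC rD /is_roughC rE.
have -> : (D `|` E)%O =
    (~` (~` D.1 `&` ~` E.1), ~` (~` D.2 `&` ~` E.2)) :> (set S *p set S).
  by rewrite !setCI !setCK.
exact: is_roughC (is_roughI rD rE).
Qed.

Lemma is_rough0 (S : approx_space) : (\bot : set S *p set S)%O \in @is_rough S.
Proof.
apply/asboolP; exists set0; congr pair; apply/seteqP; split=> x //.
- by move=> /lowerE /(_ x); apply; have [re _ _] := indisc_equiv S; exact: re.
- by move=> /upperE[].
Qed.

Lemma is_rough1 (S : approx_space) : (\top : set S *p set S)%O \in @is_rough S.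
Proof.
have -> : \top%O = (~` set0, ~` set0) :> (set S *p set S) by rewrite !setC0.
exact: is_roughC (is_rough0 S).
Qed.

(* The algebra RS: order, joins, meets and bounds are inherited from the
   componentwise ones on pairs of subsets. *)
Record rough_set (S : approx_space) : Type := RoughSet {
  rough_pair : set S *p set S;
  rough_pairP : @is_rough S rough_pair
}.

Fact rough_display : Order.disp_t. Proof. exact: Order.Disp tt tt. Qed.

HB.instance Definition _ (S : approx_space) :=
  [isSub for @rough_pair S].
HB.instance Definition _ (S : approx_space) :=
  [Choice of rough_set S by <:].
HB.instance Definition _ (S : approx_space) :=
  Order.SubChoice_isTBSubLattice.Build _ _ (@is_rough S) rough_display (rough_set S)
    (@is_roughI S) (@is_roughU S) (@is_rough0 S) (@is_rough1 S).

Lemma rough_pair_inj (S : approx_space) : injective (@rough_pair S).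
Proof. exact: val_inj. Qed.

Lemma rough_pairI (S : approx_space) (D E : rough_set S) :
  rough_pair (D `&` E)%O =
  ((rough_pair D).1 `&` (rough_pair E).1, (rough_pair D).2 `&` (rough_pair E).2).
Proof. by []. Qed.

Lemma rough_pairU (S : approx_space) (D E : rough_set S) :
  rough_pair (D `|` E)%O =
  ((rough_pair D).1 `|` (rough_pair E).1, (rough_pair D).2 `|` (rough_pair E).2).
Proof. by []. Qed.

Lemma rough_pair0 (S : approx_space) :
  rough_pair (\bot%O : rough_set S) = (set0, set0).
Proof. by []. Qed.

Lemma rough_pair1 (S : approx_space) :
  rough_pair (\top%O : rough_set S) = (setT, setT).
Proof. by []. Qed.

Lemma rough_le (S : approx_space) (D E : rough_set S) :
  (D <= E)%O <-> (rough_pair D).1 `<=` (rough_pair E).1 /\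
                 (rough_pair D).2 `<=` (rough_pair E).2.
Proof.
rewrite -Order.le_val Order.ProdOrder.leEprod.
by split=> [/andP[/subsetPset ? /subsetPset ?]|[? ?]] //;
  apply/andP; split; apply/subsetPset.
Qed.

Fact rough_meetUl (S : approx_space) :
  @left_distributive (rough_set S) _ Order.meet Order.join.
Proof.
move=> D E F; apply: rough_pair_inj.
by rewrite !(rough_pairI, rough_pairU) /= !setIUl.
Qed.

HB.instance Definition _ (S : approx_space) :=
  Order.Lattice_Meet_isDistrLattice.Build _ (rough_set S) (@rough_meetUl S).

Definition rough_neg (S : approx_space) (D : rough_set S) : rough_set S :=
  RoughSet (is_roughC (rough_pairP D)).

Fact rough_neg_meet (S : approx_space) (D E : rough_set S) :
  rough_neg (D `&` E)%O = (rough_neg D `|` rough_neg E)%O.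
Proof. by apply: rough_pair_inj; rewrite rough_pairU /= !setCI. Qed.

Fact rough_negK (S : approx_space) : involutive (@rough_neg S).
Proof. by move=> [[A B] AB]; apply: val_inj; rewrite /= !setCK. Qed.

Lemma rough_sub (S : approx_space) (D : rough_set S) :
  (rough_pair D).1 `<=` (rough_pair D).2.
Proof.
have [re _ _] := indisc_equiv S.
case: D => /= _ /asboolP[A ->] x /= /lowerE xA.
by apply/upperE; exists x; [exact: re | apply: xA; exact: re].
Qed.

Fact rough_meet_neg_le (S : approx_space) (D E : rough_set S) :
  (D `&` rough_neg D <= E `|` rough_neg E)%O.
Proof.
apply/rough_le; rewrite rough_pairI rough_pairU /=; split=> x.
  by move=> [/rough_sub].
by move=> _; have [/rough_sub|] := pselect ((rough_pair E).1 x); [left|right].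
Qed.

HB.instance Definition _ (S : approx_space) :=
  TBDistrLattice_isKleene.Build _ (rough_set S)
    (@rough_neg_meet S) (@rough_negK S) (@rough_meet_neg_le S).

Variant rough_set_algebra : forall d, kleeneType d -> Prop :=
| RoughSetAlgebra (S : approx_space) : rough_set_algebra (rough_set S).

Local Close Scope classical_set_scope.

(* The chain f < u < t is the ordinal chain 0 < 1 < 2, so that f is its bottom,
   t its top, and negation is the order reversal. *)
Definition three : Type := 'I_3.

HB.instance Definition _ := Order.Total.on three.
HB.instance Definition _ :=
  Order.hasBottom.Build _ three (fun x : 'I_3 => leq0n x : ord0 <= x).
HB.instance Definition _ :=
  Order.hasTop.Build _ three (fun x : 'I_3 => leq_ord x : x <= ord_max).

Fact three_neg_meet (x y : three) :
  (rev_ord (x `&` y) : three) = (rev_ord x : three) `|` rev_ord y.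
Proof.
by case: x => [[|[|[|m]]] //= ?]; case: y => [[|[|[|n]]] //= ?]; apply: val_inj.
Qed.

Fact three_meet_neg_le (x y : three) :
  x `&` (rev_ord x : three) <= y `|` (rev_ord y : three).
Proof.
by case: x => [[|[|[|m]]] //= ?]; case: y => [[|[|[|n]]] //= ?].
Qed.

HB.instance Definition _ :=
  TBDistrLattice_isKleene.Build _ three
    three_neg_meet (@rev_ordK 3) three_meet_neg_le.

Definition three_entails (a b : formula) : Prop :=
  (forall v : formula -> three, valuation v -> v a = \top -> v b = \top) /\
  (forall v : formula -> three, valuation v -> v b = \bot -> v a = \bot).

(* As for algebras, taking posets to be MathComp porderTypes is no restriction
   under the classical axioms; the empty poset is allowed. *)
Definition compat_frame d (W : porderType d) (C : W -> W -> Prop) : Prop :=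
  forall x y x' y' : W, x' <= x -> y' <= y -> C x y -> C x' y'.

Definition evaluation d (W : porderType d) (e : W -> nat -> Prop) : Prop :=
  forall (x y : W) p, e x p -> x <= y -> e y p.

Fixpoint forces d (W : porderType d) (C : W -> W -> Prop) (e : W -> nat -> Prop)
    (x : W) (a : formula) {struct a} : Prop :=
  match a with
  | Var p => e x p
  | Top => True
  | Bot => False
  | Or b c => forces C e x b \/ forces C e x c
  | And b c => forces C e x b /\ forces C e x c
  | Neg b => forall y, C x y -> ~ forces C e y b
  end.

Definition frame_valid d (W : porderType d) (C : W -> W -> Prop)
    (a b : formula) : Prop :=
  forall e : W -> nat -> Prop, evaluation e ->
  forall x : W, forces C e x a -> forces C e x b.

Definition frame_entails
    (F : forall d (W : porderType d), (W -> W -> Prop) -> Prop)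
    (a b : formula) : Prop :=
  forall d (W : porderType d) (C : W -> W -> Prop), F d W C ->
  frame_valid C a b.

Definition kleene_frame d (W : porderType d) (C : W -> W -> Prop) : Prop :=
  [/\ compat_frame C,
      forall x y, C x y -> C y x,
      forall x, exists y, C x y /\ forall z, C y z -> z <= x
    & forall x, C x x \/ forall y, C x y -> y <= x].

(* Main.v *)
Require Import Defs.
From mathcomp Require Import all_boot all_order.
From mathcomp Require Import boolp classical_sets.

(** A prime theory [X] and its star [X* = {c | ~c is not in X}] are comparable
    (this is what [a /\ ~a |- b \/ ~b] expresses), and the smaller and the larger
    of the two make up one three-valued valuation: [t] on the smaller set, [f] off
    the larger one. The same comparable pair arises from a point of a Kleene
    frame and the greatest point compatible with it, and it is also an evaluation
    of the two-point Kleene frame. So three-valued validity implies validity in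
    Kleene frames, and validity in the two-point frame already implies
    derivability. The algebra [three] is the rough set algebra of a two-point
    space with a single class, up to isomorphism. *)

Set Implicit Arguments.
Unset Strict Implicit.
Unset Printing Implicit Defensive.

Import Order.TTheory.

Local Open Scope order_scope.

(** * Soundness in Kleene algebras *)

Lemma kneg_le d (K : kleeneType d) (x y : K) : x <= y -> kneg y <= kneg x.
Proof. by move=> /meet_idPl <-; rewrite kneg_meet leUr. Qed.

Lemma kneg_join d (K : kleeneType d) (x y : K) :
  kneg (x `|` y) = kneg x `&` kneg y.
Proof. by rewrite -[RHS]knegK kneg_meet !knegK. Qed.

Lemma kneg_bot d (K : kleeneType d) : kneg (\bot : K) = \top.
Proof. by apply/le_anti; rewrite lex1 -[X in X <= _]knegK kneg_le ?le0x. Qed.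

Lemma derivable_sound (a b : formula) :
  derivable a b -> alg_entails (@all_kleene) a b.
Proof.
move=> ab d K _ v [vU vI vN v0 v1]; elim: ab => {a b} /=.
- by [].
- by move=> a b c _ ab _; apply: le_trans.
- by move=> a b; rewrite vI leIl.
- by move=> a b; rewrite vI leIr.
- by move=> a b c _ ab _ ac; rewrite vI lexI ab.
- by move=> a b c _ ac _ bc; rewrite vU leUx ac.
- by move=> a b; rewrite vU leUl.
- by move=> a b; rewrite vU leUr.
- by move=> a b c; rewrite !(vU, vI) meetUr.
- by move=> a b _ ab; rewrite !vN kneg_le.
- by move=> a b; rewrite vI !vN vU kneg_join.
- by move=> a; rewrite v1 lex1.
- by move=> a; rewrite v0 le0x.
- by rewrite vN v0 kneg_bot lex1.
- by move=> a; rewrite !vN knegK.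
- by move=> a; rewrite !vN knegK.
- by move=> a b; rewrite vI vU !vN meet_kneg_le.
Qed.

(** * The three-element algebra as an algebra of rough sets *)

Section ThreeAsRoughSets.
Local Open Scope classical_set_scope.

(** A second point lets a subset meet the class without containing it, as the value u requires. *)
Definition one_class_space : approx_space :=
  @ApproxSpace bool (fun _ _ => True)
    (@Relation_Definitions.Build_equivalence _ _ (fun=> I) (fun _ _ _ _ _ => I) (fun _ _ _ => I)).

Definition three_pair (x : three) : set one_class_space *p set one_class_space :=
  ([set _ | (1 < x)%N], [set _ | (0 < x)%N]).

Lemma three_pair_rough (x : three) : @is_rough one_class_space (three_pair x).
Proof.
(* For f, u and t this set is empty, the singleton of [false], and the whole space. *)
apply/asboolP; exists [set z | if z then (1 < x)%N else (0 < x)%N].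
congr pair; apply/seteqP; split=> z /=.
- move=> x1; apply/lowerE => -[] _ //=; exact: ltnW.
- by move=> /lowerE /(_ true I).
- by move=> x0; apply/upperE; exists false.
- by move=> /upperE[[] _ //=]; apply: ltnW.
Qed.

Definition three_rough (x : three) : rough_set one_class_space :=
  RoughSet (three_pair_rough x).

Lemma three_rough_le (x y : three) :
  (three_rough x <= three_rough y)%O -> (x <= y)%O.
Proof.
move=> /rough_le[/= /(_ true) h1 /(_ true) h0].
case: x y h1 h0 => [[|[|[|m]]] //= ?] [[|[|[|n]]] //= ?] h1 h0.
- by have := h0 isT.
- by have := h0 isT.
- by have := h1 isT.
Qed.

Lemma three_rough_valuation (v : formula -> three) :
  valuation v -> valuation (three_rough \o v).
Proof.
case=> vU vI vN v0 v1; split=> [a b|a b|a||] /=; apply: rough_pair_inj.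
- rewrite rough_pairU vU /= /three_pair.
  case: (v a) => [[|[|[|m]]] //= ?]; case: (v b) => [[|[|[|n]]] //= ?];
  by congr pair; apply/seteqP; split=> z //=; (tauto || case).
- rewrite rough_pairI vI /= /three_pair.
  case: (v a) => [[|[|[|m]]] //= ?]; case: (v b) => [[|[|[|n]]] //= ?];
  by congr pair; apply/seteqP; split=> z //=; (tauto || case).
- rewrite vN /= /three_pair.
  case: (v a) => [[|[|[|m]]] //= ?];
  by congr pair; apply/seteqP; split=> z //=; tauto.
- by rewrite v0; congr pair; apply/seteqP; split=> z.
- by rewrite v1; congr pair; apply/seteqP; split=> z.
Qed.

End ThreeAsRoughSets.

Lemma rough_three_entails (a b : formula) :
  alg_entails (@rough_set_algebra) a b -> three_entails a b.
Proof.
move=> ab; have le_ab (v : formula -> three) : valuation v -> v a <= v b.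
  move=> /three_rough_valuation v3; apply: three_rough_le.
  exact: (ab _ _ (RoughSetAlgebra _) _ v3).
split=> v /le_ab le_v v_eq.
  by apply/le_anti; rewrite lex1 -v_eq.
by apply/le_anti; rewrite le0x -v_eq andbT.
Qed.

(** * Three-valued valuations from a theory and its star *)

(* [Xs] plays the role of the star of [X]. *)
Record theory_with_star (X Xs : formula -> Prop) : Prop := TheoryWithStar {
  theory_top : X Top;
  theory_bot : ~ X Bot;
  theory_and a b : X (And a b) <-> X a /\ X b;
  theory_or a b : X (Or a b) <-> X a \/ X b;
  theory_neg a : X (Neg a) <-> ~ Xs a
}.

(** [p] and [q] tell membership in the smaller and in the larger theory. The impossible pair
    [(true, false)] is also sent to [\top], whence the hypothesis of [three_of_eq0]. *)
Definition three_of (p q : bool) : three :=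
  if p then \top else if q then inord 1 else \bot.

Lemma three_of_eqT (p q : bool) : three_of p q = \top <-> p.
Proof.
by case: p; case: q; split=> // /(congr1 val) /=; rewrite ?inordK.
Qed.

Lemma three_of_eq0 (p q : bool) : (p -> q) -> three_of p q = \bot <-> ~~ q.
Proof.
case: p; case: q => pq; split=> //; first by have := pq isT.
by move=> /(congr1 val); rewrite /= inordK.
Qed.

(** Joins and meets act on membership pairs componentwise. Since [P] and [Q] are stars of each
    other, negation sends [(p, q)] to [(~~ q, ~~ p)], which reverses the chain. *)
Lemma three_of_valuation (P Q : formula -> Prop) :
  theory_with_star P Q -> theory_with_star Q P -> (forall c, P c -> Q c) ->
  valuation (fun c => three_of `[< P c >] `[< Q c >]).
Proof.
move=> [PT P0 PI PU PN] [QT Q0 QI QU QN] PQ.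
have le_pq c : `[< P c >] ==> `[< Q c >].
  by apply/implyP => /asboolP /PQ /asboolP.
split=> [a b|a b|a||].
- rewrite (asbool_equiv_eq (PU a b)) (asbool_equiv_eq (QU a b)) !asbool_or.
  by move: (le_pq a) (le_pq b); do 4 case: `[< _ >] => //=;
    rewrite /three_of /=; move=> _ _; apply: val_inj; rewrite /= ?inordK.
- rewrite (asbool_equiv_eq (PI a b)) (asbool_equiv_eq (QI a b)) !asbool_and.
  by move: (le_pq a) (le_pq b); do 4 case: `[< _ >] => //=;
    rewrite /three_of /=; move=> _ _; apply: val_inj; rewrite /= ?inordK.
- rewrite (asbool_equiv_eq (PN a)) (asbool_equiv_eq (QN a)) !asbool_neg.
  by move: (le_pq a); do 2 case: `[< _ >] => //=;
    rewrite /three_of /=; move=> _; apply: val_inj; rewrite /= ?inordK.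
- by rewrite /three_of !asboolF.
- by rewrite /three_of asboolT.
Qed.

(** * Forcing in Kleene frames *)

Lemma forces_le d (W : porderType d) (C : W -> W -> Prop)
    (e : W -> nat -> Prop) (c : formula) (x y : W) :
  compat_frame C -> evaluation e -> x <= y -> forces C e x c -> forces C e y c.
Proof.
move=> compatC eval_e xy.
elim: c => [p|||c IHc c' IHc'|c IHc c' IHc'|c _] //=.
- by move=> ?; apply: eval_e xy.
- by case=> [/IHc|/IHc']; [left|right].
- by case=> /IHc ? /IHc'.
- by move=> xc z yz; apply: xc; exact: compatC xy (lexx z) yz.
Qed.

Lemma kleene_frame_star d (W : porderType d) (C : W -> W -> Prop) (x : W) :
  kleene_frame C ->
  exists y, (forall z, C x z <-> z <= y) /\ (forall z, C y z <-> z <= x).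
Proof.
case=> compatC symC starC _; have [y [xy yx]] := starC x.
exists y; split=> z; split.
(* The point [y'] obtained from [y] lies below [x], so whatever is compatible with [x] is compatible
   with [y'], hence below [y]. *)
- move=> xz; have [y' [yy' y'y]] := starC y.
  by apply: y'y; apply: compatC xz => //; exact: yx.
- by move=> zy; apply: compatC xy.
- exact: yx.
- by move=> zx; apply: compatC (symC _ _ xy).
Qed.

Lemma forces_theory d (W : porderType d) (C : W -> W -> Prop)
    (e : W -> nat -> Prop) (x y : W) :
  compat_frame C -> evaluation e -> (forall z, C x z <-> z <= y) ->
  theory_with_star (forces C e x) (forces C e y).
Proof.
move=> compatC eval_e xy; split=> //= c; split=> [xc yc|yc z /xy zy zc].
  by apply: xc yc; apply/xy.
by apply: yc; apply: forces_le zc.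
Qed.

(** If [x] lies below its star, forcing at [x] means value t, and preservation of t applies. If [x]
    lies above, forcing at [x] means a value other than f, and the f half applies
    contrapositively. *)
Lemma three_frame_entails (a b : formula) :
  three_entails a b -> frame_entails (@kleene_frame) a b.
Proof.
move=> [abt abf] d W C frameC e eval_e x xa.
have [compatC symC _ /(_ x) loC] := frameC.
have [y [xy yx]] := kleene_frame_star x frameC.
have Tx := forces_theory compatC eval_e xy.
have Ty := forces_theory compatC eval_e yx.
case: loC => [/xy le_xy|le_yx].
  have le c : forces C e x c -> forces C e y c by apply: forces_le.
  have /abt := three_of_valuation Tx Ty le.
  by rewrite !three_of_eqT => /(_ (asboolT xa)) /asboolP.
have le c : forces C e y c -> forces C e x c.
  by apply: forces_le => //; apply: le_yx; apply/xy.
have leb c : `[< forces C e y c >] -> `[< forces C e x c >].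
  by move=> /asboolP /le /asboolP.
have /abf := three_of_valuation Ty Tx le.
rewrite (three_of_eq0 (leb a)) (three_of_eq0 (leb b)) => ab; apply: contrapT => xb.
by have /asboolPn := ab (introN (asboolP _) xb).
Qed.

(** * The two-point Kleene frame *)

(* [C x y] says that [y] lies below the star [~~ x] of [x]. *)
Definition two_point_compat (x y : bool) : Prop := y <= ~~ x.

Lemma two_point_kleene_frame : kleene_frame two_point_compat.
Proof.
rewrite /two_point_compat; split.
- by do 4 case.
- by do 2 case.
- by case; [exists false | exists true]; split=> // -[].
- by case; [right; case | left].
Qed.

(** At a negation, forcing quantifies over all points below [~~ x]; by monotonicity of [T], the
    point [~~ x] alone decides. *)
Lemma forces_two_point (T : bool -> formula -> Prop) (x : bool) (c : formula) :
  (forall y, theory_with_star (T y) (T (~~ y))) ->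
  (forall c, T false c -> T true c) ->
  forces two_point_compat (fun y p => T y (Var p)) x c <-> T x c.
Proof.
move=> theoryT leT; elim: c x => [p|||c IHc c' IHc'|c IHc c' IHc'|c IHc] x /=;
  have [XT X0 XI XU XN] := theoryT x.
- by [].
- by [].
- by [].
- by rewrite XU IHc IHc'.
- by rewrite XI IHc IHc'.
- rewrite XN; split=> [xc yc|yc z].
    by apply: (xc (~~ x)); [exact: lexx | apply/IHc].
  rewrite IHc /two_point_compat; case: x z {XT X0 XI XU XN} yc => -[] //= yc _.
  by move=> /leT.
Qed.

Lemma frame_entails_theory (T : bool -> formula -> Prop) (x : bool)
    (a b : formula) :
  (forall y, theory_with_star (T y) (T (~~ y))) ->
  (forall c, T false c -> T true c) ->
  frame_entails (@kleene_frame) a b -> T x a -> T x b.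
Proof.
move=> theoryT leT ab; rewrite -!(forces_two_point _ _ theoryT leT).
apply: (ab _ _ _ two_point_kleene_frame).
by move=> [] [] p //= /leT.
Qed.

(** * Prime theories *)

Record prime_theory (X : formula -> Prop) : Prop := PrimeTheory {
  prime_up a b : derivable a b -> X a -> X b;
  prime_and a b : X a -> X b -> X (And a b);
  prime_or a b : X (Or a b) -> X a \/ X b;
  prime_top : X Top;
  prime_bot : ~ X Bot
}.

Section PrimeExtension.
Local Open Scope classical_set_scope.

(* The empty set qualifies, as required for chains in Zorn's lemma. *)
Let avoiding (a b : formula) (X : set formula) : Prop :=
  [/\ forall c d, derivable c d -> X c -> X d,
      forall c d, X c -> X d -> X (And c d),
      forall c, X c -> X a
    & ~ X b].

(** A maximal theory avoiding [b] is prime: if neither disjunct belongs to it, each one together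
    with some member derives [b], and distributivity then puts [b] in the theory. *)
Lemma prime_extension (a b : formula) : ~ derivable a b ->
  exists X, [/\ prime_theory X, X a & ~ X b].
Proof.
move=> nab; have [F subF chainF|X [[upX andX aX nbX] maxX]] :=
  @Zorn_bigcup _ (avoiding a b).
  split.
  - move=> c d cd [X FX Xc]; exists X => //.
    by have [upX _ _ _] := subF _ FX; exact: upX cd Xc.
  - move=> c d [X FX Xc] [Y FY Yd].
    have [XY|YX] := chainF _ _ FX FY.
      by exists Y => //; have [_ + _ _] := subF _ FY; apply => //; exact: XY.
    by exists X => //; have [_ + _ _] := subF _ FX; apply => //; exact: YX.
  - move=> c [X FX Xc]; exists X => //.
    by have [_ _ aX _] := subF _ FX; exact: aX Xc.
  - by case=> X FX Xb; have [_ _ _] := subF _ FX; apply.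
have Xa : X a.
  (* Without [a], the set [X] would be empty, and the theory generated by [a] would properly extend
     it. *)
  apply: contrapT => nXa; apply: (maxX (derivable a)).
    split=> [c /aX //|/(_ a (d_refl a))].
    exact: nXa.
  split=> //.
  - by move=> c d cd ac; apply: d_trans cd.
  - by move=> c d; exact: d_and.
  - by move=> *; exact: d_refl.
have extend c : ~ X c -> exists2 d, X d & derivable (And d c) b.
  (* [Y] is the theory generated by [X] and [c]; by maximality it cannot avoid [b]. *)
  move=> nXc; pose Y := [set e | exists2 d, X d & derivable (And d c) e].
  apply: contrapT => nYb; apply: (maxX Y).
    split=> [d Xd|/(_ c) YX]; first by exists d => //; exact: d_andl.
    by apply/nXc/YX; exists a => //; exact: d_andr.
  split=> //.
  - by move=> d e de [f Xf fd]; exists f => //; apply: d_trans fd de.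
  - move=> d e [f Xf fd] [g Xg ge]; exists (And f g); first exact: andX.
    apply: d_and; [apply: d_trans fd|apply: d_trans ge];
      apply: d_and (d_andr _ _); apply: d_trans (d_andl _ _) _.
      exact: d_andl.
    exact: d_andr.
  - by move=> _ _; exists a => //; exact: d_andl.
exists X; split=> //; split=> //.
- move=> c d Xcd; apply: contrapT => /not_orP[/extend[e Xe ec] /extend[f Xf fd]].
  have Xefcd : X (And (And e f) (Or c d)) by do 2 apply: (andX) => //.
  apply/nbX/(upX _ _ _ Xefcd)/(d_trans (d_distr _ _ _)).
  apply: d_or; [apply: d_trans ec|apply: d_trans fd];
    apply: d_and (d_andr _ _); apply: d_trans (d_andl _ _) _.
    exact: d_andl.
  exact: d_andr.
- by apply: upX Xa; exact: d_top.
- by move=> /(upX _ b (d_bot b)).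
Qed.

End PrimeExtension.

(** * The star of a prime theory, and completeness *)

Definition star (X : formula -> Prop) (c : formula) : Prop := ~ X (Neg c).

Lemma prime_theory_star (X : formula -> Prop) :
  prime_theory X -> theory_with_star X (star X).
Proof.
case=> upX andX orX topX botX; split=> // a => [b|b|].
- split=> [Xab|[]]; last exact: andX.
  by split; apply: upX Xab; [exact: d_andl|exact: d_andr].
- by split=> [/orX //|[]]; apply: upX; [exact: d_orl|exact: d_orr].
- by rewrite /star; split=> [Xa /(_ Xa)|/contrapT].
Qed.

(** De Morgan duality exchanges the two closure properties: the clause for meets in the star comes
    from primeness of [X], the clause for joins from closure of [X] under meets. *)
Lemma star_prime_theory (X : formula -> Prop) :
  prime_theory X -> theory_with_star (star X) X.
Proof.
case=> upX andX orX topX botX; rewrite /star; split=> [||a b|a b|a].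
- move=> XnT; apply/botX/(upX _ _ (d_dne _))/(upX _ _ _ XnT).
  exact/d_contra/d_top.
- by apply; apply: upX d_neg_bot topX.
- split=> [nXab|[nXa nXb] Xnab].
    by split=> Xn; apply: nXab; apply: upX Xn; apply: d_contra;
      [exact: d_andl|exact: d_andr].
  (* De Morgan: [~(a /\ b) |- ~a \/ ~b], obtained from [d_neg_or] *)
  have /orX[] // : X (Or (Neg a) (Neg b)).
  apply/(upX _ _ (d_dne _))/(upX _ _ _ Xnab)/d_contra.
  by apply: d_and; apply: d_trans (d_dne _); apply: d_contra;
    [exact: d_orl|exact: d_orr].
- split=> [nXab|[] nX Xnab].
  + apply: contrapT => /not_orP[/contrapT Xa /contrapT Xb]; apply: nXab.
    by apply: upX (d_neg_or _ _) _; exact: andX.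
  + by apply: nX; apply: upX Xnab; exact/d_contra/d_orl.
  + by apply: nX; apply: upX Xnab; exact/d_contra/d_orr.
- by split=> nX Xa; apply: nX; apply: upX Xa; [exact: d_dni|exact: d_dne].
Qed.

(** Consistency of [X] is exactly inclusion in its star. If [X] contains a contradiction, [d_kleene]
    puts every [Or d (Neg d)] in [X], and primeness gives the reverse inclusion. *)
Lemma star_comparable (X : formula -> Prop) : prime_theory X ->
  (forall c, X c -> star X c) \/ (forall c, star X c -> X c).
Proof.
case=> upX andX orX _ _.
have [[c [Xc Xnc]]|consistent] := pselect (exists c, X c /\ X (Neg c)).
  right=> d nXnd; have /orX[//|/nXnd //] : X (Or d (Neg d)).
  by apply: upX (d_kleene c d) _; exact: andX.
by left=> c Xc Xnc; apply: consistent; exists c.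
Qed.

Lemma frame_entails_derivable (a b : formula) :
  frame_entails (@kleene_frame) a b -> derivable a b.
Proof.
move=> ab; apply: contrapT => /prime_extension[X [primeX Xa nXb]].
have TX := prime_theory_star primeX; have TXs := star_prime_theory primeX.
apply: nXb; case: (star_comparable primeX) => le.
  (* The smaller of the two sets goes to the lower point [false]; [X] sits at [false] here and at
     [true] in the other case. *)
  pose T (x : bool) := if x then star X else X.
  by apply: (@frame_entails_theory T false a b _ _ ab Xa) => // -[].
pose T (x : bool) := if x then X else star X.
by apply: (@frame_entails_theory T true a b _ _ ab Xa) => // -[].
Qed.

Theorem theorem20 (a b : formula) :
  [<-> derivable a b;
       alg_entails (@all_kleene) a b;
       alg_entails (@rough_set_algebra) a b;
       three_entails a b;
       frame_entails (@kleene_frame) a b].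
Proof.
tfae.
- exact: derivable_sound.
- by move=> ab d K _; apply: ab.
- exact: rough_three_entails.
- exact: three_frame_entails.
- exact: frame_entails_derivable.
Qed.
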